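(* Let $f:\mathbb{R}^n\to\mathbb{R}$ be twice differentiable (in particular $f\in C^1$) and strongly convex with parameter $\lambda>0$, i.e. for all $x,y\in\mathbb{R}^n$ and $t\in[0,1]$, $$f(tx+(1-t)y)\le t f(x)+(1-t)f(y)-\tfrac12\lambda t(1-t)\|x-y\|_2^2,$$ and suppose that $\nabla f$ is Lipschitz continuous with constant $L>0$, i.e. $\|\nabla f(x)-\nabla f(y)\|_2\le L\|x-y\|_2$ for all $x,y\in\mathbb{R}^n$. Let $\mu>0$, $\phi(x)=f(x)+\mu\|x\|_1$, and let $x^\star$ be the minimizer of $\phi$ over $\mathbb{R}^n$. Let $x^0\in\mathbb{R}^n$, $\eta\in(0,1)$, $\epsilon>0$, and let $\{x^k\}_{k\ge 0}$ be any sequence generated by the Orthant-Based Adaptive Method (OBA, described in the context) run without stopping, with this $L$. Then $x^k$ converges to $x^\star$ at a linear rate; that is, there exist constants $C\ge 0$ and $\rho\in[0,1)$ such that $\|x^k-x^\star\|_2\le C\rho^k$ for all $k\ge 0$.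
   Context: Notation. $\mathrm{sgn}(t)\in\{-1,0,1\}$ with $\mathrm{sgn}(0)=0$; $\nabla_i f=\partial f/\partial x_i$. The minimum norm subgradient $g(x)$ of $\phi$ at $x$ has components: $g_i(x)=\nabla_i f(x)+\mu$ if $x_i>0$ or ($x_i=0$ and $\nabla_i f(x)+\mu<0$); $g_i(x)=\nabla_i f(x)-\mu$ if $x_i<0$ or ($x_i=0$ and $\nabla_i f(x)-\mu>0$); $g_i(x)=0$ otherwise. At an iterate $x^k$, define the nonsmooth quadratic model $$q^k(x)=f(x^k)+(x-x^k)^T\nabla f(x^k)+\tfrac12(x-x^k)^T\nabla^2 f(x^k)(x-x^k)+\mu\|x\|_1,$$ the vector $\zeta^k$ by $\zeta^k_i=\mathrm{sgn}(x^k_i)$ if $x^k_i\ne0$ and $\zeta^k_i=\mathrm{sgn}(-g_i(x^k))$ if $x^k_i=0$, and the orthant projection $\mathcal{P}^k$ by $\mathcal{P}^k_i(x)=x_i$ if $\mathrm{sgn}(x_i)=\mathrm{sgn}(\zeta^k_i)$ and $\mathcal{P}^k_i(x)=0$ otherwise. OBA method. Set $\tau^0=\lfloor\eta n\rfloor$. For $k=0,1,2,\dots$, perform the following steps. (1) Active-set identification: $\mathcal{A}^k=\{i: x^k_i=0,\ |\nabla_i f(x^k)|\le\mu\}$, $\mathcal{F}^k=\{i:x^k_i\ne0\}$, $\mathcal{U}^k=\{i:x^k_i=0,\ |\nabla_i f(x^k)|>\mu\}$. (2) Selection: set $\hat\tau^k=\min(|\mathcal{U}^k|,\tau^k)$.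 Choose any partition $\mathcal{U}^k=\mathcal{U}_F\cup\mathcal{U}_A$ (disjoint) with $|\mathcal{U}_F|=\hat\tau^k$ and $|g_i(x^k)|\ge|g_j(x^k)|$ for all $i\in\mathcal{U}_F$, $j\in\mathcal{U}_A$. Replace $\mathcal{A}^k$ by $\mathcal{A}^k\cup\mathcal{U}_A$. Let $H^k=\nabla^2 f(x^k)$. (3) Corrective cycle: repeat the following. Compute $d^k=\arg\min\{d^Tg(x^k)+\tfrac12 d^TH^kd: d_i=0 \text{ for } i\in\mathcal{A}^k\}$; set $\hat x^k=x^k+d^k$; set $V^k=\{i\in\mathcal{U}_F\setminus\mathcal{A}^k:\mathrm{sgn}(\zeta^k_i)\neq\mathrm{sgn}(\hat x^k_i)\}$; replace $\mathcal{A}^k$ by $\mathcal{A}^k\cup V^k$. Stop repeating once $V^k=\emptyset$. If only one pass was made, set $\tau^{k+1}=2\tau^k$; otherwise $\tau^{k+1}=\tau^k$. (4) Projected line search: start with $\alpha=1$ and halve $\alpha$ as long as $q^k(x^k)<q^k(\mathcal{P}^k(x^k+\alpha d^k))$. Then redefine $\hat x^k=\mathcal{P}^k(x^k+\alpha d^k)$. (5) Globalization: compute the ISTA point $x^k_{\mathrm{ISTA}}=\mathcal{S}_{\mu/L}(x^k-\tfrac1L\nabla f(x^k))$, where $\mathcal{S}_{\beta}(x)_i=\max\{|x_i|-\beta,0\}\,\mathrm{sgn}(x_i)$. Set $\bar d^k=\hat x^k-x^k_{\mathrm{ISTA}}$ and $$\Gamma^k=f(x^k)+\nabla f(x^k)^T(x^k_{\mathrm{ISTA}}-x^k)+\tfrac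 L2\|x^k_{\mathrm{ISTA}}-x^k\|_2^2+\mu\|x^k_{\mathrm{ISTA}}\|_1.$$ Start with $\bar\alpha=1$; while $\phi(x^k_{\mathrm{ISTA}}+\bar\alpha\bar d^k)>\Gamma^k$, replace $\bar\alpha$ by $\bar\alpha/2$ and, if then $\bar\alpha<\epsilon$, set $\bar\alpha=0$. Set $x^{k+1}=x^k_{\mathrm{ISTA}}+\bar\alpha\bar d^k$. *)

(* Defs.v *)
From mathcomp Require Import all_boot all_order all_algebra.
From mathcomp Require Import all_classical all_reals all_analysis.

Set Implicit Arguments.
Unset Strict Implicit.
Unset Printing Implicit Defensive.

Import Order.TTheory GRing.Theory Num.Theory.
Import numFieldNormedType.Exports.
Local Open Scope ring_scope.

(* Points of R^n are row vectors.  The canonical norm `|x| of 'rV[R]_n is the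
   sup norm, so the norms below have to be defined; the resulting topology,
   and hence differentiability, is the same. *)

Definition dotv (R : realType) (n : nat) (u v : 'rV[R]_n) : R :=
  (u *m v^T) 0 0.

Definition norm2 (R : realType) (n : nat) (u : 'rV[R]_n) : R :=
  Num.sqrt (dotv u u).

Definition norm1 (R : realType) (n : nat) (u : 'rV[R]_n) : R :=
  \sum_(i < n) `|u 0 i|.

Definition grad (R : realType) (n : nat) (f : 'rV[R]_n -> R)
    (x : 'rV[R]_n) : 'rV[R]_n :=
  \row_(i < n) 'D_(delta_mx 0 i) f x.

(* The (i, j) entry is the i-th partial derivative of the j-th partial
   derivative of f at x, jacobian being the matrix of 'd acting on rows. *)
Definition hessian (R : realType) (n : nat) (f : 'rV[R]_n -> R)
    (x : 'rV[R]_n) : 'M[R]_n :=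
  'J (grad f) x.

Definition twice_differentiable (R : realType) (n : nat)
    (f : 'rV[R]_n -> R) : Prop :=
  (forall x, differentiable f x) /\ (forall x, differentiable (grad f) x).

Definition strongly_convex (R : realType) (n : nat) (lambda : R)
    (f : 'rV[R]_n -> R) : Prop :=
  forall (x y : 'rV[R]_n) (t : R), 0 <= t <= 1 ->
    f (t *: x + (1 - t) *: y) <=
      t * f x + (1 - t) * f y
      - 2^-1 * lambda * t * (1 - t) * norm2 (x - y) ^+ 2.

Definition is_argmin (R : realType) (T : Type) (S : set T) (F : T -> R)
    (x : T) : Prop :=
  S x /\ forall y, S y -> F x <= F y.

(* while_loop c body s t : the loop "while c do body", started in state s,
   terminates in state t. *)
Inductive while_loop (T : Type) (c : T -> bool) (body : T -> T) :
    T -> T -> Prop :=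
| while_stop s : ~~ c s -> while_loop c body s s
| while_step s t : c s -> while_loop c body (body s) t -> while_loop c body s t.

Definition phi (R : realType) (n : nat) (f : 'rV[R]_n -> R) (mu : R)
    (x : 'rV[R]_n) : R :=
  f x + mu * norm1 x.

Definition min_norm_subgrad (R : realType) (n : nat) (f : 'rV[R]_n -> R)
    (mu : R) (x : 'rV[R]_n) : 'rV[R]_n :=
  \row_(i < n)
    let df := grad f x 0 i in
    if (0 < x 0 i) || ((x 0 i == 0) && (df + mu < 0)) then df + mu
    else if (x 0 i < 0) || ((x 0 i == 0) && (0 < df - mu)) then df - mu
    else 0.

(* The model q^k, with xk the current iterate. *)
Definition qmodel (R : realType) (n : nat) (f : 'rV[R]_n -> R) (mu : R)
    (xk x : 'rV[R]_n) : R :=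
  f xk + dotv (x - xk) (grad f xk)
  + 2^-1 * dotv ((x - xk) *m hessian f xk) (x - xk)
  + mu * norm1 x.

Definition zeta (R : realType) (n : nat) (f : 'rV[R]_n -> R) (mu : R)
    (xk : 'rV[R]_n) : 'rV[R]_n :=
  \row_(i < n)
    if xk 0 i != 0 then Num.sg (xk 0 i)
    else Num.sg (- min_norm_subgrad f mu xk 0 i).

Definition orthant_proj (R : realType) (n : nat) (z x : 'rV[R]_n) : 'rV[R]_n :=
  \row_(i < n) if Num.sg (x 0 i) == Num.sg (z 0 i) then x 0 i else 0.

Definition soft_threshold (R : realType) (n : nat) (beta : R)
    (x : 'rV[R]_n) : 'rV[R]_n :=
  \row_(i < n) (Num.max (`|x 0 i| - beta) 0 * Num.sg (x 0 i)).

Definition active_set (R : realType) (n : nat) (f : 'rV[R]_n -> R) (mu : R)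
    (xk : 'rV[R]_n) : {set 'I_n} :=
  [set i | (xk 0 i == 0) && (`|grad f xk 0 i| <= mu)].

Definition undecided_set (R : realType) (n : nat) (f : 'rV[R]_n -> R) (mu : R)
    (xk : 'rV[R]_n) : {set 'I_n} :=
  [set i | (xk 0 i == 0) && (mu < `|grad f xk 0 i|)].

Definition oba_selection (R : realType) (n : nat) (f : 'rV[R]_n -> R) (mu : R)
    (xk : 'rV[R]_n) (tauk : nat) (UF UA : {set 'I_n}) : Prop :=
  let U := undecided_set f mu xk in
  let g := min_norm_subgrad f mu xk in
  [/\ UF :|: UA = U, [disjoint UF & UA],
      #|UF| = minn #|U| tauk
    & forall i j, i \in UF -> j \in UA -> `|g 0 j| <= `|g 0 i| ].

Definition reduced_newton_direction (R : realType) (n : nat)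
    (f : 'rV[R]_n -> R) (mu : R) (xk : 'rV[R]_n) (A : {set 'I_n})
    (d : 'rV[R]_n) : Prop :=
  is_argmin [set e : 'rV[R]_n | forall i, i \in A -> e 0 i = 0]%classic
    (fun e => dotv e (min_norm_subgrad f mu xk)
              + 2^-1 * dotv (e *m hessian f xk) e)
    d.

Definition violators (R : realType) (n : nat) (f : 'rV[R]_n -> R) (mu : R)
    (xk : 'rV[R]_n) (UF A : {set 'I_n}) (d : 'rV[R]_n) : {set 'I_n} :=
  [set i in UF :\: A |
    Num.sg (zeta f mu xk 0 i) != Num.sg ((xk + d) 0 i)].

(* corrective_cycle f mu xk UF A d p : started with active set A, the cycle
   terminates after p passes and d is the direction computed in the last
   one. *)
Inductive corrective_cycle (R : realType) (n : nat) (f : 'rV[R]_n -> R)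
    (mu : R) (xk : 'rV[R]_n) (UF : {set 'I_n}) :
    {set 'I_n} -> 'rV[R]_n -> nat -> Prop :=
| corrective_stop A d :
    reduced_newton_direction f mu xk A d ->
    violators f mu xk UF A d = finset.set0 ->
    corrective_cycle f mu xk UF A d 1
| corrective_next A e d p :
    reduced_newton_direction f mu xk A e ->
    violators f mu xk UF A e <> finset.set0 ->
    corrective_cycle f mu xk UF (A :|: violators f mu xk UF A e) d p ->
    corrective_cycle f mu xk UF A d p.+1.

Definition projected_line_search (R : realType) (n : nat) (f : 'rV[R]_n -> R)
    (mu : R) (xk d : 'rV[R]_n) (alpha : R) : Prop :=
  while_loop
    (fun a => qmodel f mu xk xk
              < qmodel f mu xk (orthant_proj (zeta f mu xk) (xk + a *: d)))
    (fun a => a / 2) 1 alpha.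

Definition ista_point (R : realType) (n : nat) (f : 'rV[R]_n -> R)
    (mu L : R) (xk : 'rV[R]_n) : 'rV[R]_n :=
  soft_threshold (mu / L) (xk - L^-1 *: grad f xk).

(* Gamma^k *)
Definition ista_bound (R : realType) (n : nat) (f : 'rV[R]_n -> R)
    (mu L : R) (xk : 'rV[R]_n) : R :=
  let y := ista_point f mu L xk in
  f xk + dotv (grad f xk) (y - xk) + L / 2 * norm2 (y - xk) ^+ 2
  + mu * norm1 y.

Definition globalization (R : realType) (n : nat) (f : 'rV[R]_n -> R)
    (mu L eps : R) (xk xhat : 'rV[R]_n) (abar : R) : Prop :=
  let y := ista_point f mu L xk in
  while_loop
    (fun a => ista_bound f mu L xk < phi f mu (y + a *: (xhat - y)))
    (fun a => if a / 2 < eps then 0 else a / 2) 1 abar.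

(* One iteration, from (x^k, tau^k) to (x^(k+1), tau^(k+1)). *)
Definition oba_step (R : realType) (n : nat) (f : 'rV[R]_n -> R)
    (mu L eps : R) (xk : 'rV[R]_n) (tauk : nat)
    (xk1 : 'rV[R]_n) (tauk1 : nat) : Prop :=
  exists (UF UA : {set 'I_n}) (d : 'rV[R]_n) (p : nat) (alpha abar : R),
    let y := ista_point f mu L xk in
    let xhat := orthant_proj (zeta f mu xk) (xk + alpha *: d) in
    [/\ oba_selection f mu xk tauk UF UA,
        corrective_cycle f mu xk UF (active_set f mu xk :|: UA) d p /\
          tauk1 = (if p == 1%N then 2 * tauk else tauk)%N,
        projected_line_search f mu xk d alpha,
        globalization f mu L eps xk xhat abar
      & xk1 = y + abar *: (xhat - y) ].

Definition oba_sequence (R : realType) (n : nat) (f : 'rV[R]_n -> R)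
    (mu L eta eps : R) (x : nat -> 'rV[R]_n) (tau : nat -> nat) : Prop :=
  (tau 0%N)%:Z = Num.floor (eta * n%:R) /\
  forall k, oba_step f mu L eps (x k) (tau k) (x k.+1) (tau k.+1).

(* Main.v *)
Require Import Defs.
From mathcomp Require Import all_boot all_order all_algebra.
From mathcomp Require Import all_classical all_reals all_analysis.
From mathcomp Require Import ring lra.
Import Order.TTheory GRing.Theory Num.Theory.
Import numFieldNormedType.Exports.
Local Open Scope ring_scope.

(** The globalization step makes OBA at least as good as one ISTA step, and
    this forces the linear rate.  Its backtracking loop can only be left at a
    point whose objective value is at most Gamma^k, which is the minimum over z
    of the model
    [f(x^k) + <grad f(x^k), z - x^k> + (L/2) |z - x^k|^2 + mu |z|_1]
    ([ista_bound_le]).  At [z = x^k + t (xstar - x^k)], strong convexity bounds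
    the linear term ([strongly_convex_gradient]), and the resulting terms in
    [|xstar - x^k|^2], with total coefficient [t (L t - lambda) / 2], are
    nonpositive as soon as [L t <= lambda].  Hence with
    [t = min(1, lambda / L)] the gap [phi(x^k) - phi(xstar)] is multiplied by
    at most [1 - t] at each iteration ([ista_bound_contraction]).  Strong
    convexity makes the gap dominate [(lambda / 4) |x^k - xstar|^2]
    ([quadratic_growth]), so the iterates converge with rate
    [sqrt (1 - t)]. *)

(** * Inner product and norms *)

Lemma dotvE (R : realType) (n : nat) (u v : 'rV[R]_n) :
  dotv u v = \sum_i u 0 i * v 0 i.
Proof. by rewrite /dotv mxE; apply: eq_bigr => i _; rewrite mxE. Qed.

Lemma dotvZr (R : realType) (n : nat) (a : R) (u v : 'rV[R]_n) :
  dotv u (a *: v) = a * dotv u v.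
Proof.
by rewrite !dotvE mulr_sumr; apply: eq_bigr => i _; rewrite mxE mulrCA.
Qed.

Lemma sqr_norm2 (R : realType) (n : nat) (u : 'rV[R]_n) :
  norm2 u ^+ 2 = \sum_i u 0 i ^+ 2.
Proof.
rewrite sqr_sqrtr dotvE; first by apply: eq_bigr.
by apply: sumr_ge0 => i _; rewrite -expr2 sqr_ge0.
Qed.

Lemma sqr_norm2Z (R : realType) (n : nat) (a : R) (u : 'rV[R]_n) :
  norm2 (a *: u) ^+ 2 = a ^+ 2 * norm2 u ^+ 2.
Proof.
by rewrite !sqr_norm2 mulr_sumr; apply: eq_bigr => i _; rewrite mxE exprMn.
Qed.

Lemma norm1_convex (R : realType) (n : nat) (x y : 'rV[R]_n) (t : R) :
  0 <= t <= 1 ->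
  norm1 (t *: x + (1 - t) *: y) <= t * norm1 x + (1 - t) * norm1 y.
Proof.
move=> /andP[t0 t1]; rewrite /norm1 !mulr_sumr -big_split /=.
apply: ler_sum => i _; rewrite !mxE (le_trans (ler_normD _ _))//.
by rewrite !normrM (ger0_norm t0) [`|1 - t|]ger0_norm ?subr_ge0.
Qed.

(** * Strong convexity *)

Lemma derive_grad (R : realType) (n : nat) (f : 'rV[R]_n -> R)
    (x h : 'rV[R]_n) :
  differentiable f x -> 'D_h f x = dotv (grad f x) h.
Proof.
move=> df; rewrite deriveE// {1}(row_sum_delta h) linear_sum dotvE /=.
by apply: eq_bigr => i _; rewrite linearZ mxE deriveE// mulrC.
Qed.

(** Dividing the strong convexity inequality between [x] and [y] by the weight
    [s] of [y] and letting [s] tend to 0 from the right turns the chord into a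
    tangent. *)
Lemma strongly_convex_gradient (R : realType) (n : nat) (lambda : R)
    (f : 'rV[R]_n -> R) (x y : 'rV[R]_n) :
  strongly_convex lambda f -> differentiable f x ->
  f x + dotv (grad f x) (y - x) + lambda / 2 * norm2 (y - x) ^+ 2 <= f y.
Proof.
move=> fconv df; set N := norm2 (y - x) ^+ 2.
pose c := lambda / 2 * N.
pose q (s : R) := s^-1 *: (f (s *: (y - x) + x) - f x).
have q_cvg : (q s @[s --> 0^'+] --> dotv (grad f x) (y - x))%classic.
  rewrite -derive_grad//; apply: cvg_dnbhs_at_right.
  exact: (diff_derivable (v := y - x) df).
have b_cvg : ((f y - f x - c) + c * s @[s --> 0^'+] --> f y - f x - c)%classic.
  apply: cvg_at_right_filter; rewrite -[X in (_ --> X)%classic]addr0.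
  apply: cvgD; first exact: cvg_cst.
  rewrite -[X in (_ --> X)%classic](mulr0 c).
  by apply: cvgM; [exact: cvg_cst | exact: cvg_id].
suff : dotv (grad f x) (y - x) <= f y - f x - c by rewrite -/c; lra.
apply: (ler_cvg_to q_cvg b_cvg); near=> s.
have s0 : 0 < s by near: s; exact: nbhs_right_gt.
have s1 : s < 1 by near: s; exact: nbhs_right_lt.
have := fconv y x s; rewrite (ltW s0) (ltW s1) => /(_ isT).
have -> : s *: y + (1 - s) *: x = s *: (y - x) + x.
  by rewrite scalerBr scalerBl scale1r addrCA addrC -addrA [- _ + x]addrC.
rewrite -/N => chord; rewrite /q /GRing.scale/= mulrC ler_pdivrMr//.
by rewrite /c; lra.
Unshelve. all: by end_near. Qed.

(** The midpoint of [x] and the minimizer already gives a quadratic lower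
    bound on the gap, with constant [lambda / 4]. *)
Lemma quadratic_growth (R : realType) (n : nat) (f : 'rV[R]_n -> R)
    (lambda mu : R) (xstar x : 'rV[R]_n) :
  0 <= mu -> strongly_convex lambda f ->
  is_argmin [set: 'rV[R]_n]%classic (phi f mu) xstar ->
  lambda / 4 * norm2 (x - xstar) ^+ 2 <= phi f mu x - phi f mu xstar.
Proof.
move=> mu0 fconv [_ xmin].
have half01 : 0 <= (2^-1 : R) <= 1 by lra.
have := xmin (2^-1 *: x + (1 - 2^-1) *: xstar) I.
have := fconv x xstar _ half01.
have := ler_wpM2l mu0 (norm1_convex _ _ x xstar _ half01).
by rewrite /phi; lra.
Qed.

(** * The ISTA bound *)

(** This says that [b - p] is a subgradient of [beta |.|] at [p], for [p] the
    soft-thresholding of [b]: it is the optimality condition that characterizes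
    [p] as the proximal point of [b]. *)
Lemma soft_threshold_subgradient (R : realType) (beta b u : R) :
  0 <= beta ->
  let p := Num.max (`|b| - beta) 0 * Num.sg b in
  (b - p) * (u - p) <= beta * (`|u| - `|p|).
Proof.
move=> beta0 /=; have [bsmall|bbig] := leP (`|b| - beta) 0.
  rewrite mul0r normr0 !subr0 (le_trans (ler_norm _))// normrM.
  by rewrite ler_wpM2r// -subr_le0.
have [b0|bpos|bneg] := sgrP b.
- by move: bbig; rewrite b0 normr0; lra.
- rewrite mulr1; move: bbig; rewrite (gtr0_norm bpos) => bbig.
  rewrite [`|b - beta|]gtr0_norm//; have := ler_wpM2l beta0 (ler_norm u); lra.
- move: bbig; rewrite (ltr0_norm bneg) => bbig.
  rewrite mulrN1 normrN [`|- b - beta|]gtr0_norm//.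
  by have := ler_wpM2l beta0 (ler_norm (- u)); rewrite normrN; lra.
Qed.

(** Coordinatewise, the difference of the two sides is [(L / 2) (z_i - p_i)^2]
    plus [L] times the slack in the subgradient inequality. *)
Lemma ista_bound_le (R : realType) (n : nat) (f : 'rV[R]_n -> R)
    (mu L : R) (x z : 'rV[R]_n) :
  0 <= mu -> 0 < L ->
  ista_bound f mu L x <=
    f x + dotv (grad f x) (z - x) + L / 2 * norm2 (z - x) ^+ 2 + mu * norm1 z.
Proof.
move=> mu0 L0; rewrite /ista_bound !dotvE !sqr_norm2 /norm1 -!addrA lerD2l.
rewrite !mulr_sumr -!big_split /=; apply: ler_sum => i _.
rewrite !mxE; set g := 'D__ _ _; set a := x 0 i; set u := z 0 i.
have := @soft_threshold_subgradient R (mu / L) (a - L^-1 * g) u.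
rewrite divr_ge0 ?(ltW L0)// => /(_ isT) /=; set p := _ * Num.sg _ => subg.
have := ler_wpM2l (ltW L0) subg.
have -> : L * ((a - L^-1 * g - p) * (u - p)) = (L * (a - p) - g) * (u - p).
  by field; rewrite gt_eqF.
have -> : L * (mu / L * (`|u| - `|p|)) = mu * (`|u| - `|p|).
  by field; rewrite gt_eqF.
have := mulr_ge0 (ltW L0) (sqr_ge0 (u - p)).
by lra.
Qed.

Lemma ista_bound_contraction (R : realType) (n : nat) (f : 'rV[R]_n -> R)
    (lambda mu L t : R) (x z : 'rV[R]_n) :
  differentiable f x -> strongly_convex lambda f -> 0 <= mu -> 0 < L ->
  0 <= t <= 1 -> L * t <= lambda ->
  ista_bound f mu L x <= t * phi f mu z + (1 - t) * phi f mu x.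
Proof.
move=> df fconv mu0 L0 t01 Lt; have /andP[t0 _] := t01.
apply: le_trans (@ista_bound_le R n f mu L x (t *: z + (1 - t) *: x) mu0 L0) _.
have -> : t *: z + (1 - t) *: x - x = t *: (z - x).
  by rewrite scalerBl scale1r scalerBr [x - _]addrC addrA addrK.
rewrite dotvZr sqr_norm2Z /phi.
have := ler_wpM2l mu0 (norm1_convex _ _ z x t t01).
have := ler_wpM2l t0 (@strongly_convex_gradient R n lambda f x z fconv df).
have := mulr_ge0 t0 (sqr_ge0 (norm2 (z - x))) => tN.
have := ler_wpM2r tN Lt.
by lra.
Qed.

(** * Convergence of OBA *)

Lemma while_loop_exit (T : Type) (c : T -> bool) (body : T -> T) (s t : T) :
  while_loop c body s t -> ~~ c t.
Proof. by elim. Qed.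

Lemma oba_step_descent (R : realType) (n : nat) (f : 'rV[R]_n -> R)
    (mu L eps : R) (xk xk1 : 'rV[R]_n) (tauk tauk1 : nat) :
  oba_step f mu L eps xk tauk xk1 tauk1 ->
  phi f mu xk1 <= ista_bound f mu L xk.
Proof.
move=> [UF [UA [d [p [alpha [abar [_ _ _ search ->]]]]]]].
by rewrite leNgt; exact: while_loop_exit search.
Qed.

Theorem theoremA4 (R : realType) (n : nat) (f : 'rV[R]_n -> R)
    (lambda L mu eta eps : R) (xstar : 'rV[R]_n)
    (x : nat -> 'rV[R]_n) (tau : nat -> nat)
    (hf : twice_differentiable f)
    (hlambda : 0 < lambda) (hconvex : strongly_convex lambda f)
    (hL : 0 < L)
    (hlip : forall y z : 'rV[R]_n,
       norm2 (grad f y - grad f z) <= L * norm2 (y - z))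
    (hmu : 0 < mu)
    (hxstar : is_argmin [set: 'rV[R]_n]%classic (phi f mu) xstar)
    (heta : 0 < eta < 1) (heps : 0 < eps)
    (hx : oba_sequence f mu L eta eps x tau) :
  exists C rho : R,
    [/\ 0 <= C, 0 <= rho, rho < 1
      & forall k : nat, norm2 (x k - xstar) <= C * rho ^+ k ].
Proof.
have mu0 := ltW hmu.
pose gap k := phi f mu (x k) - phi f mu xstar.
pose t := Num.min 1 (lambda / L).
have t0 : 0 < t by rewrite lt_min ltr01 divr_gt0.
have t1 : t <= 1 by rewrite ge_min lexx.
have Lt : L * t <= lambda.
  by rewrite mulrC -ler_pdivlMr// ge_min lexx orbT.
have contraction k : gap k.+1 <= (1 - t) * gap k.
  have t01 : 0 <= t <= 1 by rewrite ltW.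
  have := @ista_bound_contraction R n f lambda mu L t (x k) xstar
            (hf.1 _) hconvex mu0 hL t01 Lt.
  by have := oba_step_descent _ _ _ _ _ _ _ _ _ _ (hx.2 k); rewrite /gap; lra.
have gap_le k : gap k <= gap 0%N * (1 - t) ^+ k.
  elim: k => [|k IH]; first by rewrite mulr1.
  rewrite (le_trans (contraction k))// exprS mulrCA.
  by rewrite ler_wpM2l ?subr_ge0.
have gap0 : 0 <= 4 / lambda * gap 0%N.
  by rewrite mulr_ge0 ?divr_ge0 ?(ltW hlambda)// subr_ge0 hxstar.2.
exists (Num.sqrt (4 / lambda * gap 0%N)), (Num.sqrt (1 - t)).
split; [exact: sqrtr_ge0 | exact: sqrtr_ge0 | |] => [|k].
  by rewrite -[ltRHS]sqrtr1 ltr_sqrt ?ltr01//; lra.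
rewrite -ler_sqr ?nnegrE ?mulr_ge0 ?exprn_ge0 ?sqrtr_ge0//.
rewrite exprMn exprAC (sqr_sqrtr gap0) (@sqr_sqrtr _ (1 - t)) ?subr_ge0//.
have := quadratic_growth _ _ _ _ _ _ (x k) mu0 hconvex hxstar.
move=> /le_trans /(_ (gap_le k)) growth.
have -> : norm2 (x k - xstar) ^+ 2 =
    4 / lambda * (lambda / 4 * norm2 (x k - xstar) ^+ 2).
  by field; rewrite gt_eqF.
by rewrite -[leRHS]mulrA ler_wpM2l// divr_ge0 ?(ltW hlambda).
Qed.
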